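(* Let $a<c$ be real numbers and let $f:[a,c]\to\mathbb{R}$ be continuous on $[a,c]$ and differentiable on $(a,c)$ with $f'(x)\ge -1$ for every $x\in(a,c)$. Suppose that $f(x)>x$ for each $x\in[a,c)$ and that $c$ is the unique fixed point of $f$ in $[a,c]$. Let $x_0\in[a,c)$ and for each $n\ge 0$ define $$x_{n+1}=\frac{x_n+f(x_n)}{2}.$$ Then the sequence $\{x_n\}$ converges to $c$.
   Context: A fixed point of $f$ is a point $x$ of its domain with $f(x)=x$. The assertion that the recursively defined sequence converges includes that it is well defined, i.e. every $x_n$ lies in the domain $[a,c]$ of $f$. *)

(* Defs.v *)
From mathcomp Require Import all_boot all_order all_algebra.
From mathcomp Require Import all_classical all_reals all_analysis.

(* Main.v *)
(* The slope bound keeps the averaged iterates at or below c, and f x > x makes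
   them nondecreasing, so they converge; by continuity the limit is a fixed
   point of f, hence c. *)
Require Import Defs.
From mathcomp Require Import all_boot all_order all_algebra.
From mathcomp Require Import all_classical all_reals all_analysis.
From mathcomp Require Import lra.
Import Order.TTheory GRing.Theory Num.Theory numFieldNormedType.Exports.
Local Open Scope classical_set_scope.
Local Open Scope ring_scope.

(* The mean value theorem on [y, c] with slope >= -1 and f c = c gives
   f y <= 2 c - y. *)
Lemma avg_le_fixpoint (R : realType) (a c : R) (f : R -> R) (y : R) :
  {within `[a, c], continuous f} ->
  (forall x, x \in `]a, c[ -> derivable f x 1) ->
  (forall x, x \in `]a, c[ -> -1 <= f^`()%classic x) ->
  f c = c -> y \in `[a, c] -> (y + f y) / 2 <= c.
Proof.
move=> f_cont f_diff f_deriv f_fix; rewrite in_itv /= => /andP[ay].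
rewrite le_eqVlt => /predU1P[->|yc]; first by rewrite f_fix; lra.
have sub z : z \in `]y, c[ -> z \in `]a, c[.
  by rewrite !in_itv /= => /andP[yz ->]; rewrite (le_lt_trans ay yz).
have f_der z : z \in `]y, c[ -> is_derive z 1 f (f^`()%classic z).
  by move=> /sub/f_diff dz; rewrite derive1E; exact: derivableP.
have f_cont_yc : {within `[y, c], continuous f}.
  apply: continuous_subspaceW f_cont => z /=.
  by rewrite !in_itv /= => /andP[yz ->]; rewrite (le_trans ay yz).
have [z zyc] := MVT yc f_der f_cont_yc.
(* The slope bound at [z] is multiplied by [c - y > 0]. *)
by have := f_deriv _ (sub _ zyc); rewrite f_fix; nra.
Qed.

(** As [u] stays in [A], it tends to [l] along [within A (nbhs l)], where relative continuity
    suffices. The limit may thus be an endpoint of the domain, as [c] will be. *)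
Lemma cvg_within_comp (R : realType) (A : set R) (f : R -> R) (u : R^nat)
    (l : R) :
  {within A, continuous f} -> (forall n, A (u n)) -> A l ->
  u n @[n --> \oo] --> l -> f (u n) @[n --> \oo] --> f l.
Proof.
move=> f_cont uA lA ul.
have fl : f z @[z --> within A (nbhs l)] --> f l.
  rewrite (nbhs_subspace_in lA); exact: f_cont.
apply: cvg_comp fl => B /= /ul uB.
by apply: (@filterS _ \oo _ _ _ _ uB) => n /(_ (uA n)).
Qed.

(* f is a total function on R of which only the restriction to [a, c] is
   constrained.  The first conjunct says that the recursion stays in [a, c],
   so the sequence depends only on that restriction. *)
Theorem lemma2p3 (R : realType) (a c : R) (f : R -> R)
  (hac : a < c)
  (f_cont : {within `[a, c], continuous f})
  (f_diff : forall x, x \in `]a, c[ -> derivable f x 1)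
  (f_deriv : forall x, x \in `]a, c[ -> -1 <= f^`()%classic x)
  (f_gt : forall x, x \in `[a, c[ -> x < f x)
  (f_fix : f c = c)
  (f_uniq : forall x, x \in `[a, c] -> f x = x -> x = c)
  (x0 : R) (hx0 : x0 \in `[a, c[)
  (x : R^nat)
  (x_init : x 0%N = x0)
  (x_rec : forall n : nat, x n.+1 = (x n + f (x n)) / 2) :
  (forall n : nat, x n \in `[a, c]) /\ x n @[n --> \oo] --> c.
Proof.
have x_in n : x n \in `[a, c].
  elim: n => [|n IHn].
    by move: hx0; rewrite x_init !in_itv /= => /andP[-> /ltW].
  have := avg_le_fixpoint _ _ _ _ _ f_cont f_diff f_deriv f_fix IHn.
  rewrite -x_rec => xc; move: (IHn); rewrite !in_itv /= xc andbT => /andP[ax].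
  (* An iterate may equal [c], where [f_gt] is silent: [f z = 2 * c - z] gets there in one step. *)
  rewrite le_eqVlt => /predU1P[xnc|xnc].
    by rewrite x_rec xnc f_fix; lra.
  have : x n < f (x n) by apply: f_gt; rewrite in_itv /= ax.
  by rewrite x_rec; lra.
split=> //.
have x_le n : x n <= c by have := x_in n; rewrite in_itv => /andP[].
have x_ge n : a <= x n by have := x_in n; rewrite in_itv => /andP[].
have x_nd : nondecreasing_seq x.
  apply/nondecreasing_seqP => n.
  have := x_le n; rewrite [_ <= c]le_eqVlt => /predU1P[xnc|xnc].
    by rewrite x_rec xnc f_fix; lra.
  have : x n < f (x n) by apply: f_gt; rewrite in_itv /= x_ge.
  by rewrite x_rec; lra.
have [l xl] : exists l : R, x n @[n --> \oo] --> l.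
  exists (limn x); apply: nondecreasing_is_cvgn => //.
  by exists c => _ [n _ <-].
(* Weak bounds pass to the limit, so [l] stays where [f] is controlled. *)
have l_in : l \in `[a, c].
  have x_cvg : cvgn x by apply/cvg_ex; exists l.
  rewrite -(cvg_lim (@Rhausdorff R) xl) in_itv /=.
  by rewrite limr_ge ?limr_le //; exact: nearW.
have fx_cvg : f (x n) @[n --> \oo] --> f l.
  exact: cvg_within_comp _ _ _ _ _ f_cont x_in l_in xl.
(* The shifted sequence gets two limits, one through the recursion and one as a tail of [x];
   equating them gives [f l = l]. *)
have avg_cvg : x n.+1 @[n --> \oo] --> (l + f l) / 2.
  under eq_fun do rewrite x_rec.
  by apply: cvgMl; exact: cvgD.
have xS_cvg : x n.+1 @[n --> \oo] --> l by rewrite (cvg_shiftS x).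
have l_eq : (l + f l) / 2 = l by exact: cvg_unique _ avg_cvg xS_cvg.
by rewrite -(_ : l = c) //; apply: f_uniq => //; lra.
Qed.
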